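(* Let $A,B\in\mathbb R^2$ be distinct points. For real numbers $s,t>0$ with $s\neq 1$, consider the Cartesian ovals $$\|A-M\|+\sigma_1 s\|B-M\|=\sigma_2 t,\qquad \sigma_1,\sigma_2\in\{-1,1\}.$$ The evolute of the closure of the Cartesian ovals is the complete caustic by refraction given the radiant point $A$, the circle $\mathcal C$ with center $$O=A+\frac{s^2}{s^2-1}(B-A)$$ and radius $r=\dfrac{s\|A-B\|}{|s^2-1|}$, and the refraction constant $n=\dfrac{s\|A-B\|}{t}$.
   Context: $\|\cdot\|$ is the Euclidean norm on $\mathbb R^2$. Cartesian ovals. For distinct points $A,B\in\mathbb R^2$ (foci) and real $s,t$, the set of $M\in\mathbb R^2$ with $\|A-M\|+s\|B-M\|=t$ is called a Cartesian oval. Depending on the parameters it may be empty, a single point, or a real curve. The four ovals with signs $\sigma_1,\sigma_2$ are contained in the algebraic plane curve $\big(\|A-M\|^2-s^2\|B-M\|^2+t^2\big)^2-4t^2\|A-M\|^2=0$, whose real points are exactly the union of the four ovals. ''Closure'' means Zariski closure; its evolute is the envelope of the normals to the real curves among the four ovals. Refracted rays. Fix a radiant point $A\in\mathbb R^2$ and a plane curve $\mathcal C$. For a smooth point $X\in\mathcal C$, $X\ne A$, the light ray $L(X)$ is the line through $A$ and $X$, and $N(X)$ is the normal line of $\mathcal C$ at $X$. For two lines $L_0,L_1$ meeting at $X$, the angle of $L_1$ with respect to $L_0$ is the unique $\theta\in(-\pi/2,\pi/2]$ by which $L_0$ must be rotated around $X$ to become $L_1$. Let $\theta_{\mathrm{in}}$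 be the angle of $L(X)$ with respect to $N(X)$. For a real $n\ne0$ (the refraction constant) with $\frac1n\sin\theta_{\mathrm{in}}\in[-1,1]$, the refracted ray $R_n(X)$ is the line through $X$ whose angle $\theta_{\mathrm{out}}$ with respect to $N(X)$ satisfies $\sin\theta_{\mathrm{in}}=n\sin\theta_{\mathrm{out}}$ (with $\theta_{\mathrm{out}}=0$ if $\theta_{\mathrm{in}}=0$). The envelope of a family of curves in the plane is a curve that is tangent to each curve of the family at some point, such that these points of tangency form the whole curve. The complete caustic by refraction given $A,\mathcal C,n$ is the envelope of all refracted rays $R_n(X)$ and $R_{-n}(X)$. The evolute of a plane curve is the envelope of its family of normal lines (normals), taken at smooth points. *)

(* Defs.v *)
(* MathComp-Analysis, over an arbitrary R : realType; the plane is 'rV[R]_2. *)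
From HB Require Import structures.
From mathcomp Require Import all_boot all_order all_algebra.
From mathcomp Require Import all_classical all_reals all_analysis.
From mathcomp Require mpoly.

Set Implicit Arguments.
Unset Strict Implicit.
Unset Printing Implicit Defensive.

Import Order.TTheory GRing.Theory Num.Theory.
Import numFieldNormedType.Exports.

Local Open Scope classical_set_scope.
Local Open Scope ring_scope.

Section Plane.
Context {R : realType}.
Implicit Types (A B C M P X u v : 'rV[R]_2) (l : set 'rV[R]_2).

Definition dot u v : R := u 0 0 * v 0 0 + u 0 1 * v 0 1.

Definition cross u v : R := u 0 0 * v 0 1 - u 0 1 * v 0 0.

(* The library norm `|u| on 'rV_2 is the sup norm. *)
Definition enorm u : R := Num.sqrt (dot u u).

(* A genuine line only when v != 0. *)
Definition line P v : set 'rV[R]_2 := [set P + a *: v | a in [set: R]].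

Definition rotation (theta : R) v : 'rV[R]_2 :=
  \row_j (if j == 0 then cos theta * v 0 0 - sin theta * v 0 1
                    else sin theta * v 0 0 + cos theta * v 0 1).

Definition line_angle X (l0 l1 : set 'rV[R]_2) (theta : R) : Prop :=
  - (pi / 2) < theta <= pi / 2 /\
  l1 = [set X + rotation theta (Q - X) | Q in l0].

Definition circle O (r : R) : set 'rV[R]_2 := [set X | enorm (X - O) = r].

End Plane.

Section AlgebraicCurves.
Context {R : realType}.
Implicit Types (S : set 'rV[R]_2) (P v : 'rV[R]_2) (l : set 'rV[R]_2).
Implicit Types f : mpoly.mpoly 2 R.

(* Evaluation at P applies to P 0 : 'I_2 -> R, the coordinates of P. *)
Definition vanishing_ideal S : set (mpoly.mpoly 2 R) :=
  [set f | forall Q, S Q -> mpoly.meval (Q 0) f = 0].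

Definition zariski_closure S : set 'rV[R]_2 :=
  [set P | forall f, vanishing_ideal S f -> mpoly.meval (P 0) f = 0].

Definition gradient f P : 'rV[R]_2 :=
  \row_i mpoly.meval (P 0) (mpoly.mderiv i f).

(* Zariski tangent space, as a space of directions. *)
Definition tangent_space S P : set 'rV[R]_2 :=
  [set v | forall f, vanishing_ideal S f -> dot (gradient f P) v = 0].

(* At a singular point of a plane curve the tangent space is the whole
   plane; at an isolated component it is 0. *)
Definition smooth_point S P : Prop :=
  S P /\ exists2 tau : 'rV[R]_2, tau != 0 &
    tangent_space S P = [set a *: tau | a in [set: R]].

Definition normal_line S P l : Prop :=
  exists2 nu : 'rV[R]_2,
    nu != 0 /\ (forall v, tangent_space S P v -> dot nu v = 0) &
    l = line P nu.

End AlgebraicCurves.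

Section Envelopes.
Context {R : realType}.
Implicit Types (F : set (set 'rV[R]_2)) (S : set 'rV[R]_2) (P : 'rV[R]_2).

(* P lies on a smooth arc all of whose tangent lines belong to F.  Nonzero
   curvature (which entails that the velocity is nonzero) makes the tangent
   line vary along the arc; otherwise every line of F, being tangent to itself
   everywhere, would be such an arc. *)
Definition envelope_point F P : Prop :=
  exists (a b : R) (gamma : R -> 'rV[R]_2),
    (forall (k : nat) u, a < u < b -> derivable (derive1n k gamma) u 1) /\
    (forall u, a < u < b ->
       cross (derive1 gamma u) (derive1n 2 gamma u) != 0 /\
       F (line (gamma u) (derive1 gamma u))) /\
    (exists2 u, a < u < b & P = gamma u).

(* The curve formed by all the points of tangency.  The topological closure
   adds the cusps and the other limit points of the arcs, at which the curve
   has a tangent but no regular parametrization.  A pencil of concurrent lines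
   contributes nothing: its only candidate envelope is a point, not a curve. *)
Definition envelope F : set 'rV[R]_2 := closure (envelope_point F).

Definition evolute S : set 'rV[R]_2 :=
  envelope [set l | exists2 P, smooth_point S P & normal_line S P l].

End Envelopes.

Section Refraction.
Context {R : realType}.
Implicit Types (A B M X : 'rV[R]_2) (C l N : set 'rV[R]_2).

(* l is the refracted ray R_n(X) for the radiant point A and the curve C.
   No line l qualifies when `|sin theta_in| > `|n|. *)
Definition refracted_ray A C (n : R) X l : Prop :=
  smooth_point C X /\ X != A /\
  exists N (theta_in theta_out : R),
    [/\ normal_line C X N,
        line_angle X N (line A (X - A)) theta_in,
        line_angle X N l theta_out &
        sin theta_in = n * sin theta_out].

Definition complete_caustic A C (n : R) : set 'rV[R]_2 :=
  envelope [set l | exists X,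
    refracted_ray A C n X l \/ refracted_ray A C (- n) X l].

Definition cartesian_oval A B (s t : R) : set 'rV[R]_2 :=
  [set M | enorm (A - M) + s * enorm (B - M) = t].

(* The union of the four ovals with signs sigma_1, sigma_2 in {-1, 1}. *)
Definition cartesian_ovals A B (s t : R) : set 'rV[R]_2 :=
  \bigcup_(e in [set: bool * bool])
    cartesian_oval A B ((-1) ^+ e.1 * s) ((-1) ^+ e.2 * t).

End Refraction.

(* Main.v *)
(* A point [M] of the ovals has signed distances [a], [b] to [A], [B] with [a + s b = t], and
   the normal there has direction [g = b (M - A) + s a (M - B)], which vanishes only if [M] is
   [A] or [B].  This normal meets the Apollonius circle [|X - A| = s |X - B|], which is [C], at a
   point [X] of the circle through [A], [B], [M]; Ptolemy's equality there reads
   [|X - M| |A - B| = t |X - B|], and it makes the line [X M] a ray refracted at [X] with constant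
   [n] or [- n].  Conversely every refracted ray that avoids [A], [B] and the center of [C] is the
   normal at such an [M].  So the two families of lines agree up to three pencils, and a pencil
   does not change an envelope: where an arc has nonzero curvature, its tangents cannot all pass
   through one point, so some subarc near any of its points avoids the pencil. *)
Require Import Defs.
From mathcomp Require Import all_boot all_order all_algebra.
From mathcomp Require Import all_classical all_reals all_analysis.
From mathcomp Require Import ring lra.
From mathcomp Require mpoly.
Import (canonicals, coercions) mpoly.
Import Order.TTheory GRing.Theory Num.Theory.
Import numFieldNormedType.Exports.
Local Open Scope classical_set_scope.
Local Open Scope ring_scope.

Set Implicit Arguments.
Unset Strict Implicit.


(** * Polynomials along a curve: ring induction and the chain rule *)

Lemma mpoly_ring_ind (n : nat) (K : comNzRingType) (P : mpoly.mpoly n K -> Prop) :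
  (forall c, P (mpoly.mpolyC n c)) ->
  (forall i, P (mpoly.mpolyX K (mpoly.mnm1 i))) ->
  (forall p q, P p -> P q -> P (p + q)) ->
  (forall p q, P p -> P q -> P (p * q)) ->
  forall p, P p.
Proof.
move=> PC PX PD PM p; rewrite (mpoly.mpolyE p).
have P1 : P 1 by rewrite -mpoly.mpolyC1.
apply: big_ind => [||m _]; [by rewrite -mpoly.mpolyC0 | exact: PD |].
rewrite -mpoly.mul_mpolyC; apply: (PM) => //; rewrite mpoly.mpolyXE_id.
apply: big_ind => [||i _]; [by [] | exact: PM |].
by elim: (m i) => [|k IH]; rewrite ?expr0 // exprS; apply: PM.
Qed.

Lemma mderiv_var (n : nat) (K : comNzRingType) (i j : 'I_n) :
  mpoly.mderiv i (mpoly.mpolyX K (mpoly.mnm1 j)) = (i == j)%:R.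
Proof.
rewrite mpoly.mderivX mpoly.mnm1E eq_sym; have [->|_] := eqVneq i j.
  rewrite scale1r -mpoly.mpolyX0; congr mpoly.mpolyX.
  by apply/mpoly.mnmP => k; rewrite mpoly.mnmBE mpoly.mnm0E subnn.
by rewrite scale0r.
Qed.

(** The chain rule. Both sides obey the sum and product rules, so constants and variables
    suffice. *)
Lemma meval_is_derive (R : realType) (n : nat) (f : mpoly.mpoly n R)
    (x : 'I_n -> R -> R) (dx : 'I_n -> R) (u : R) :
  (forall i, is_derive u 1 (x i) (dx i)) ->
  is_derive u 1 (fun w => mpoly.meval (x^~ w) f)
    (\sum_i mpoly.meval (x^~ u) (mpoly.mderiv i f) * dx i).
Proof.
move=> dxP; elim/mpoly_ring_ind: f => [c|j|p q IHp IHq|p q IHp IHq].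
- rewrite big1 => [|i _]; last by rewrite mpoly.mderivC mpoly.meval0 mul0r.
  by under eq_fun do rewrite mpoly.mevalC; exact: is_derive_cst.
- rewrite (bigD1 j) //= big1 => [|i /negPf ij].
    rewrite mderiv_var eqxx mpoly.meval1 mul1r addr0.
    by under eq_fun do rewrite mpoly.mevalXU; exact: dxP.
  by rewrite mderiv_var ij mpoly.meval0 mul0r.
- under eq_fun do rewrite mpoly.mevalD.
  apply: is_derive_eq; rewrite -big_split /=.
  by apply: eq_bigr => i _; rewrite mpoly.mderivD mpoly.mevalD mulrDl.
- under eq_fun do rewrite mpoly.mevalM.
  apply: is_derive_eq; rewrite !scaler_sumr -big_split /=.
  apply: eq_bigr => i _.
  rewrite mpoly.mderivM mpoly.mevalD !mpoly.mevalM /GRing.scale /=; ring.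
Qed.

(** * Lines, rotations and angles in the plane *)

Section Plane.
Context {R : realType}.
Implicit Types (A B M P X Z u v w : 'rV[R]_2) (l : set 'rV[R]_2).

Lemma row2P u v : u 0 0 = v 0 0 -> u 0 1 = v 0 1 -> u = v.
Proof.
move=> e0 e1; apply/rowP => i.
by case: (unliftP 0 i) => [j|] ->; rewrite // ord1; move: e1; congr (u _ _ = v _ _); apply/val_inj.
Qed.

Lemma row2_neq0 v : (v != 0) = (v 0 0 != 0) || (v 0 1 != 0).
Proof.
rewrite -negb_and; congr (~~ _); apply/eqP/andP => [->|[/eqP e0 /eqP e1]].
  by rewrite !mxE.
by apply: row2P; rewrite !mxE.
Qed.

Lemma dot_gt0 v : v != 0 -> 0 < dot v v.
Proof. rewrite row2_neq0 /dot => /orP[] h; nra. Qed.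

Lemma dot_ge0 v : 0 <= dot v v.
Proof. rewrite /dot; nra. Qed.

Lemma enorm_sqr v : enorm v ^+ 2 = dot v v.
Proof. by rewrite sqr_sqrtr // dot_ge0. Qed.

Lemma enorm_gt0 v : v != 0 -> 0 < enorm v.
Proof. by move=> v0; rewrite sqrtr_gt0 dot_gt0. Qed.

Lemma crossC u v : cross u v = - cross v u.
Proof. by rewrite /cross; ring. Qed.

Lemma cross_eq0 u v : u != 0 -> cross u v = 0 -> exists k, v = k *: u.
Proof.
rewrite row2_neq0 /cross => /orP[] h /eqP; rewrite subr_eq0 => /eqP e.
- exists (v 0 0 / u 0 0); apply: row2P; rewrite !mxE; first by field.
  by apply: (mulfI h); rewrite e; field.
- exists (v 0 1 / u 0 1); apply: row2P; rewrite !mxE; last by field.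
  by apply: (mulfI h); rewrite [LHS]mulrC [LHS]mulrC -e; field.
Qed.

Lemma lineZ P v k : k != 0 -> line P (k *: v) = line P v.
Proof.
move=> k0; apply/seteqP; split=> _ [c _ <-] /=.
  by exists (c * k) => //; rewrite scalerA.
by exists (c / k) => //; rewrite scalerA divfK.
Qed.

Lemma lineD P v k : line (P + k *: v) v = line P v.
Proof.
apply/seteqP; split=> _ [c _ <-] /=.
  by exists (k + c) => //; rewrite scalerDl addrA.
by exists (c - k) => //; rewrite -addrA -scalerDl subrKC.
Qed.

Lemma line_base P Q v : line P v Q -> line P v = line Q v.
Proof. by case=> c _ <-; rewrite lineD. Qed.

Lemma line_cross P v Z : line P v Z -> cross (Z - P) v = 0.
Proof. by case=> c _ <-; rewrite /cross !mxE; ring. Qed.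

Lemma line_crossP P v Z : v != 0 -> cross (Z - P) v = 0 -> line P v Z.
Proof.
move=> v0 c0; have [|k e] := @cross_eq0 v (Z - P) v0.
  by rewrite crossC c0 oppr0.
by exists k => //; rewrite -e addrC subrK.
Qed.

Lemma line_eq_cross P u v : line P u = line P v -> cross u v = 0.
Proof.
move=> e; have : line P u (P + u) by exists 1; rewrite // scale1r.
rewrite e => -[c _] /addrI <-; rewrite /cross !mxE; ring.
Qed.

Lemma cross_eq0_line P u v : u != 0 -> v != 0 -> cross u v = 0 ->
  line P u = line P v.
Proof.
move=> u0 v0 /(cross_eq0 u0)[k e]; rewrite e lineZ //.
by apply: contraNneq v0 => k0; rewrite e k0 scale0r.
Qed.

Lemma rotation_line X u (theta : R) :
  [set X + rotation theta (Q - X) | Q in line X u] = line X (rotation theta u).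
Proof.
apply/seteqP; split=> [_ [_ [c _ <-] <-]|_ [c _ <-]].
  exists c => //; congr (_ + _).
  by apply: row2P; rewrite !mxE /=; ring.
exists (X + c *: u); first by exists c.
by congr (_ + _); apply: row2P; rewrite !mxE /=; ring.
Qed.

(** The line fixes [v] only as a multiple of the rotated [u]; squaring removes the dependence on the
    orientations of both vectors. *)
Lemma line_angle_sin X u v theta : u != 0 -> v != 0 ->
  line_angle X (line X u) (line X v) theta ->
  cross u v ^+ 2 = sin theta ^+ 2 * dot u u * dot v v.
Proof.
move=> u0 v0 [_]; rewrite rotation_line => /esym/line_eq_cross c0.
have r0 : rotation theta u != 0.
  have := dot_gt0 u0; have := cos2Dsin2 theta => e h.
  have : dot (rotation theta u) (rotation theta u) = dot u u.
    rewrite -[RHS]mul1r -e /dot !mxE /=; ring.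
  by move=> e2; apply: contra_eq_neq e2 => ->; rewrite /dot !mxE mul0r addr0 lt_eqF.
have [k ->] := cross_eq0 r0 c0.
have := cos2Dsin2 theta; rewrite /cross /dot !mxE /= => e.
move: (cos theta) (sin theta) e => c s e.
rewrite -[LHS]mulr1 -e; ring.
Qed.

(** The arctangent of [cross u v / dot u v] serves unless the directions are orthogonal; that case
    takes the closed end [pi / 2] of the range of angles. *)
Lemma line_angle_ex X u v : u != 0 -> v != 0 ->
  exists theta, line_angle X (line X u) (line X v) theta.
Proof.
move=> u0 v0.
have nu := enorm_gt0 u0; have nv := enorm_gt0 v0.
have [d0|d0] := eqVneq (dot u v) 0.
  exists (pi / 2); split; first by have := pi_gt0 R; lra.
  rewrite rotation_line; apply: cross_eq0_line => //.
    by move: u0; rewrite !row2_neq0 !mxE /= cos_pihalf sin_pihalf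
      !mul0r !mul1r add0r addr0 oppr_eq0 orbC.
  rewrite -[RHS]d0 /cross /dot !mxE /= cos_pihalf sin_pihalf; ring.
exists (atan (cross u v / dot u v)); split.
  by rewrite ltW ?andbT ?atan_ltpi2 // atan_gtNpi2.
set th := atan _; rewrite rotation_line.
have cth : cos th != 0 by rewrite gt_eqF // cos_gt0_pihalf // atan_gtNpi2 atan_ltpi2.
have e : sin th = cos th * (cross u v / dot u v).
  by rewrite -[_ / _ in RHS]atanK -/th /tan mulrC divfK.
have r : rotation th u = (cos th * dot u u / dot u v) *: v.
  by apply: row2P; rewrite !mxE /= e; move: d0; rewrite /cross /dot => d0; field.
rewrite r lineZ // !mulf_neq0 ?invr_neq0 // gt_eqF // dot_gt0 //.
Qed.

End Plane.

(** * Zariski tangent spaces and normals of plane curves *)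

Section Curves.
Context {R : realType}.
Implicit Types (S C : set 'rV[R]_2) (O P X Z tau u v nu : 'rV[R]_2) (l : set 'rV[R]_2).
Implicit Types f : mpoly.mpoly 2 R.

(** A polynomial that vanishes on [S] is constantly zero along [c] near [w0], so its derivative
    there, given by the chain rule, is zero. *)
Lemma tangent_space_curve S (c : R -> 'rV[R]_2) v (w0 : R) :
  (forall i, is_derive w0 1 (fun w => c w 0 i) (v 0 i)) ->
  (\forall w \near w0, S (c w)) -> tangent_space S (c w0) v.
Proof.
move=> dc Sc f fS.
have D1 := meval_is_derive f dc.
have D2 : is_derive w0 1 (fun w => mpoly.meval (c w 0) f) 0.
  apply: (@near_eq_is_derive _ _ _ (cst 0)).
  by near=> w; apply/esym/fS; near: w.
rewrite -[RHS](@derive_val _ _ _ _ _ _ _ D2) (@derive_val _ _ _ _ _ _ _ D1).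
rewrite /dot big_ord_recl big_ord1 !mxE.
by congr (_ + mpoly.meval _ (mpoly.mderiv _ _) * v _ _); apply/val_inj.
Unshelve. all: by end_near. Qed.

Lemma orthogonal_cross tau u v : tau != 0 -> dot u tau = 0 -> dot v tau = 0 ->
  cross u v = 0.
Proof.
move=> /dot_gt0; rewrite lt_neqAle eq_sym => /andP[t0 _] ut vt; apply: (mulIf t0).
transitivity (dot u tau * cross tau v - dot v tau * cross tau u).
  rewrite /cross /dot; ring.
by rewrite ut vt !mul0r subr0.
Qed.

(** The gradient confines the tangent space to a line, and [tau] shows that it is not zero. *)
Lemma smooth_point_tangent S f P tau : vanishing_ideal S f -> S P ->
  gradient f P != 0 -> tau != 0 -> tangent_space S P tau -> smooth_point S P.
Proof.
move=> fS SP g0 tau0 Ttau; split=> //; exists tau => //.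
apply/seteqP; split=> [v Tv|_ [k _ <-] h hS] /=.
  have [k ->] : exists k, v = k *: tau; last by exists k.
  apply: cross_eq0 => //; apply: (orthogonal_cross g0).
    by have := Ttau f fS; rewrite /dot mulrC [X in _ + X]mulrC.
  by have := Tv f fS; rewrite /dot mulrC [X in _ + X]mulrC.
by have := Ttau h hS; rewrite /dot !mxE => e; rewrite -[RHS](mulr0 k) -e; ring.
Qed.

(** At a smooth point the tangent space is a line, so its orthogonal directions are all parallel.
    Any one polynomial of the ideal with nonzero gradient gives the normal; it need not generate the
    ideal. *)
Lemma normal_line_gradient S f P l : vanishing_ideal S f ->
  gradient f P != 0 -> smooth_point S P ->
  normal_line S P l <-> l = line P (gradient f P).
Proof.
move=> fS g0 [SP [tau tau0 TE]].
have Ttau : tangent_space S P tau by rewrite TE; exists 1; rewrite ?scale1r.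
split=> [[nu [nu0 nuT] ->]|->].
  by apply: cross_eq0_line => //; apply: (orthogonal_cross tau0) (nuT _ Ttau) (Ttau f fS).
by exists (gradient f P) => //; split=> // v Tv; apply: Tv.
Qed.

(** At [r = 0] this is the squared distance to [O], from which [ovals_poly] is built. *)
Definition circle_poly O (r : R) : mpoly.mpoly 2 R :=
  let x (i : 'I_2) := mpoly.mpolyX R (mpoly.mnm1 i) - mpoly.mpolyC 2 (O 0 i) in
  x 0 * x 0 + x 1 * x 1 - mpoly.mpolyC 2 (r ^+ 2).

Lemma meval_circle_poly O r P :
  mpoly.meval (P 0) (circle_poly O r) = dot (P - O) (P - O) - r ^+ 2.
Proof.
rewrite /circle_poly mpoly.mevalB mpoly.mevalD !mpoly.mevalM !mpoly.mevalB.
by rewrite !mpoly.mevalC !mpoly.mevalXU /dot !mxE.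
Qed.

Lemma gradient_circle_poly O r P : gradient (circle_poly O r) P = 2 *: (P - O).
Proof.
apply: row2P; rewrite !mxE /circle_poly mpoly.mderivB mpoly.mderivD !mpoly.mderivM;
  rewrite !mpoly.mderivB !mpoly.mderivC !mderiv_var /=;
  rewrite !(mpoly.mevalB, mpoly.mevalD, mpoly.mevalM, mpoly.mevalC, mpoly.mevalXU,
            mpoly.meval1, mpoly.meval0); ring.
Qed.

End Curves.

(** * Envelopes are insensitive to pencils of lines *)

Section Envelopes.
Context {R : realType}.
Implicit Types (F : set (set 'rV[R]_2)) (P Z : 'rV[R]_2) (gamma : R -> 'rV[R]_2).

Lemma coord_is_derive gamma (u : R) i : derivable gamma u 1 ->
  is_derive u 1 (fun w => gamma w 0 i) (derive1 gamma u 0 i).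
Proof.
move=> dg; rewrite derive1E derive_mx // mxE.
by apply: DeriveDef => //; apply: (derivable_mxP gamma u 1).1.
Qed.

Lemma near_between (a u b : R) : a < u < b -> \forall w \near u, a < w < b.
Proof.
move=> /andP[au ub]; near=> w; apply/andP; split; near: w;
[exact: lt_nbhsr|exact: lt_nbhsl].
Unshelve. all: by end_near. Qed.

(** The tangent at [u] passes through [Z] only if [phi u = 0]. If [phi] is nonzero somewhere,
    continuity gives the subarc. If [phi] vanishes identically, so does its derivative; then
    [gamma u - Z], if nonzero, is parallel to both the velocity and the acceleration, which are
    independent. Hence [gamma] is constantly [Z], against its nonzero velocity. *)
Lemma arc_leaves_pencil gamma (a b : R) Z : a < b ->
  (forall u, a < u < b -> [/\ derivable gamma u 1, derivable (derive1 gamma) u 1 &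
     cross (derive1 gamma u) (derive1 (derive1 gamma) u) != 0]) ->
  exists a' b', [/\ a <= a', a' < b', b' <= b &
    forall u, a' < u < b' -> cross (gamma u - Z) (derive1 gamma u) != 0].
Proof.
move=> ab arc; pose phi u := cross (gamma u - Z) (derive1 gamma u).
have dphi u : a < u < b ->
    is_derive u 1 phi (cross (gamma u - Z) (derive1 (derive1 gamma) u)).
  move=> /arc[dg dg1 _].
  have ig i := coord_is_derive i dg; have ig1 i := coord_is_derive i dg1.
  rewrite /phi /cross; under eq_fun do rewrite !mxE.
  apply: is_derive_eq; rewrite !mxE /GRing.scale /=; ring.
have [[u1 u1ab phi1]|phi0] := pselect (exists2 u, a < u < b & phi u != 0).
  have cphi : {for u1, continuous phi}.
    by apply/differentiable_continuous/derivable1_diffP; have [] := dphi u1 u1ab.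
  have : \forall w \near u1, phi w != 0 /\ a < w < b.
    near=> w; split; last by near: w; exact: near_between.
    near: w; apply: (cvgr_neq0 (phi u1) cphi phi1).
  (* Halving [e] keeps the right end inside the ball, hence below [b]. *)
  move=> /nbhs_ballP[e /= e0 He]; exists u1, (u1 + e / 2).
  have He' u : u1 - e < u < u1 + e -> phi u != 0 /\ a < u < b.
    by move=> h; apply: He; rewrite /ball /= ltr_distlC.
  split; first by case/andP: u1ab => /ltW.
  - lra.
  - have [_ /andP[_ /ltW]] := He' (u1 + e / 2) ltac:(lra).
    by [].
  - by move=> u /andP[h1 h2]; apply: (He' u _).1; lra.
have {}phi0 u : a < u < b -> phi u = 0.
  by move=> h; apply/eqP/negPn/negP => h'; apply: phi0; exists u.
have gZ u : a < u < b -> gamma u = Z.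
  move=> uab; have [_ _ c0] := arc u uab.
  have e1 := phi0 u uab.
  have D : is_derive u 1 phi 0.
    apply: (@near_eq_is_derive _ _ _ (cst 0)).
    by near=> w; rewrite phi0 //; near: w; exact: near_between.
  have e2 := @derive_val _ _ _ _ _ _ _ D.
  rewrite (@derive_val _ _ _ _ _ _ _ (dphi u uab)) in e2.
  have [//|gn] := eqVneq (gamma u) Z; rewrite -subr_eq0 in gn.
  have [k1 h1] := cross_eq0 gn e1; have [k2 h2] := cross_eq0 gn e2.
  by move: c0; rewrite h1 h2 /cross !mxE => /eqP[]; ring.
pose m := (a + b) / 2; have mab : a < m < b by rewrite /m; lra.
have [_ _] := arc m mab; suff -> : derive1 gamma m = 0.
  by rewrite /cross !mxE !mul0r subrr eqxx.
rewrite derive1E (@near_eq_derive _ _ _ _ (cst Z)) ?derive_cst //.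
by near=> w; rewrite gZ //; near: w; exact: near_between.
Unshelve. all: by end_near. Qed.

(** Arbitrarily close to [P] the arc has subarcs whose tangents avoid [Z] and so belong to [F2].
    This makes [P] a limit of envelope points of [F2], which is why the conclusion is about the
    closed set [envelope F2]. *)
Lemma envelope_point_pencil F1 F2 Z : (forall l, F1 l -> F2 l \/ l Z) ->
  envelope_point F1 `<=` envelope F2.
Proof.
move=> F12 P [a [b [gamma [dg [gF [u0 u0ab ->]]]]]] U.
have cg : {for u0, continuous gamma}.
  by apply/differentiable_continuous/derivable1_diffP; apply: (dg 0%N).
move=> /cg nU.
have : \forall w \near u0, U (gamma w) /\ a < w < b.
  near=> w; split; near: w; [exact: nU | exact: near_between].
move=> /nbhs_ballP[e /= e0 He].
have {}He u : u0 - e < u < u0 + e -> U (gamma u) /\ a < u < b.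
  by move=> h; apply: He; rewrite /ball /= ltr_distlC.
have [||a' [b' [h1 h2 h3 h4]]] := @arc_leaves_pencil gamma u0 (u0 + e / 2) Z.
- lra.
- move=> u uI; have [|_ uab] := He u; first by lra.
  split; [exact: (dg 0%N)|exact: (dg 1%N)|].
  by have [] := gF u uab.
have He' u : a' < u < b' -> U (gamma u) /\ a < u < b by move=> h; apply: He; lra.
pose m := (a' + b') / 2; have mab : a' < m < b' by rewrite /m; lra.
exists (gamma m); split; last exact: (He' m mab).1.
exists a', b', gamma; split; [|split; last by exists m].
  by move=> k u /He'[_]; apply: dg.
move=> u uI; have [_ uab] := He' u uI; have [? /F12[//|/line_cross c0]] := gF u uab.
move: (h4 u uI); rewrite -[X in X != _]opprK /cross => /eqP[].
by rewrite -[RHS]oppr0 -c0 /cross !mxE; ring.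
Unshelve. all: by end_near. Qed.

Lemma envelope_pencil F1 F2 Z : (forall l, F1 l -> F2 l \/ l Z) ->
  envelope F1 `<=` envelope F2.
Proof.
move=> /envelope_point_pencil F12.
rewrite /envelope [X in _ `<=` X](_ : _ = closure (envelope F2)); first exact: closureS.
by apply/closure_id; exact: closed_closure.
Qed.

End Envelopes.

(** * The circle and its normals *)

Lemma circleP (R : realType) (O P : 'rV[R]_2) (r : R) : 0 < r ->
  circle O r P <-> dot (P - O) (P - O) = r ^+ 2.
Proof.
move=> r0; rewrite -enorm_sqr; split=> [->//|/eqP].
by rewrite eqrXn2 // ?sqrtr_ge0 ?ltW // => /eqP.
Qed.

Lemma circle_normal (R : realType) (O X : 'rV[R]_2) (r : R) :
  0 < r -> circle O r X ->
  smooth_point (circle O r) X /\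
  forall l, normal_line (circle O r) X l <-> l = line X (X - O).
Proof.
move=> r0 XC.
have XO : X - O != 0.
  by apply: contraTneq r0 => e; rewrite -XC e /enorm /dot !mxE !mulr0 addr0 sqrtr0 ltxx.
have fC : vanishing_ideal (circle O r) (circle_poly O r).
  by move=> P /(circleP _ _ r0) e; rewrite meval_circle_poly e subrr.
have g0 : gradient (circle_poly O r) X != 0.
  by rewrite gradient_circle_poly scaler_eq0 negb_or XO pnatr_eq0.
have sX : smooth_point (circle O r) X.
  (* Rotating [X] about [O] gives an arc of the circle; [v] is its velocity at [w = 0]. *)
  pose c w := O + rotation w (X - O).
  pose v : 'rV[R]_2 := \row_i (if i == 0 then - (X - O) 0 1 else (X - O) 0 0).
  apply: (@smooth_point_tangent _ _ (circle_poly O r) _ v) => //.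
    by move: XO; rewrite !row2_neq0 !mxE /= oppr_eq0 orbC.
  have c0 : c 0 = X.
    by apply: row2P; rewrite !mxE /= sin0 cos0; ring.
  rewrite -c0; apply: tangent_space_curve => [i|].
    rewrite /c /v; under eq_fun do rewrite !mxE; rewrite !mxE.
    case: ifP => _; apply: is_derive_eq; rewrite /GRing.scale /= ?sin0 ?cos0; ring.
  near=> w; apply/(circleP _ _ r0); move/(circleP _ _ r0): XC => <-.
  rewrite /dot !mxE /= -[RHS]mulr1 -(cos2Dsin2 w); ring.
split=> // l; have := normal_line_gradient l fC g0 sX.
by rewrite gradient_circle_poly lineZ // pnatr_eq0.
Unshelve. all: by end_near. Qed.

(** * Equation, normals and smooth points of the Cartesian ovals *)

Section Ovals.
Context {R : realType}.
Implicit Types (A B M O P Q X u v : 'rV[R]_2) (l : set 'rV[R]_2).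

Lemma dot_comb (x y : R) u v :
  dot (x *: u + y *: v) (x *: u + y *: v) =
  x ^+ 2 * dot u u + y ^+ 2 * dot v v + x * y * (2 * dot u v).
Proof. rewrite /dot !mxE; ring. Qed.

Lemma cross_comb (x y z w : R) u v :
  cross (x *: u + y *: v) (z *: u + w *: v) = (x * w - y * z) * cross u v.
Proof. rewrite /cross !mxE; ring. Qed.

Lemma dotB u v : dot (u - v) (u - v) = dot u u + dot v v - 2 * dot u v.
Proof. rewrite /dot !mxE; ring. Qed.

Lemma dotBC A B : dot (A - B) (A - B) = dot (B - A) (B - A).
Proof. rewrite /dot !mxE; ring. Qed.

Lemma sqr_signed (a x : R) : 0 <= x -> a ^+ 2 = x ^+ 2 -> exists i : bool, a = (-1) ^+ i * x.
Proof.
move=> x0 /eqP; rewrite eqf_sqr => /orP[] /eqP ->.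
  by exists false; rewrite mul1r.
by exists true; rewrite mulN1r.
Qed.

(* Signed distances [a] and [b] absorb the four sign patterns. *)
Lemma cartesian_ovalsP A B (s t : R) M : cartesian_ovals A B s t M <->
  exists a b, [/\ a ^+ 2 = dot (M - A) (M - A), b ^+ 2 = dot (M - B) (M - B) &
    a + s * b = t].
Proof.
have n1 (i : bool) : ((-1) ^+ i) * ((-1) ^+ i) = 1 :> R.
  by case: i; rewrite ?mulrNN mulr1.
split=> [[[i j] _ /= e]|[a [b [ea eb e]]]].
  (* Multiplying the equation of the oval by [(-1) ^+ j] makes its right side [t]. *)
  exists ((-1) ^+ j * enorm (A - M)), ((-1) ^+ i * (-1) ^+ j * enorm (B - M)).
  rewrite !exprMn !enorm_sqr -!exprM !(mulnC _ 2) !exprM sqrrN !expr1n !mul1r.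
  split; [exact: dotBC | exact: dotBC |].
  transitivity ((-1) ^+ j * ((-1) ^+ j * t)); last by rewrite mulrA n1 mul1r.
  rewrite -e; ring.
have [i ei] : exists i : bool, a = (-1) ^+ i * enorm (A - M).
  by apply: sqr_signed; rewrite ?sqrtr_ge0 // enorm_sqr ea dotBC.
have [j ej] : exists j : bool, b = (-1) ^+ j * enorm (B - M).
  by apply: sqr_signed; rewrite ?sqrtr_ge0 // enorm_sqr eb dotBC.
(* Multiplying by the sign of [a] makes the coefficient of [enorm (A - M)] equal to 1, so that sign
   moves to [t] and combines with the sign of [b]. *)
exists (i (+) j, i) => //=; rewrite signr_addb -e ei ej.
rewrite /cartesian_oval /= mulrDr mulrA n1 mul1r; ring.
Qed.

(** With signed distances, squaring [s * b = t - a] gives [u = 2 * t * a]; squaring once more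
    eliminates [a]. *)
Definition ovals_poly A B (s t : R) : mpoly.mpoly 2 R :=
  let pa := circle_poly A 0 in
  let u := pa - mpoly.mpolyC 2 (s ^+ 2) * circle_poly B 0 + mpoly.mpolyC 2 (t ^+ 2) in
  u * u - mpoly.mpolyC 2 (4 * t ^+ 2) * pa.

Lemma meval_ovals_poly A B (s t : R) P (da := dot (P - A) (P - A))
    (db := dot (P - B) (P - B)) :
  mpoly.meval (P 0) (ovals_poly A B s t) =
  (da - s ^+ 2 * db + t ^+ 2) ^+ 2 - 4 * t ^+ 2 * da.
Proof.
rewrite /ovals_poly.
move: (circle_poly A 0) (meval_circle_poly A 0 P) => pa; rewrite -/da => ea.
move: (circle_poly B 0) (meval_circle_poly B 0 P) => pb; rewrite -/db => eb.
by rewrite !(mpoly.mevalB, mpoly.mevalD, mpoly.mevalM, mpoly.mevalC) ea eb; ring.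
Qed.

Lemma gradient_ovals_poly A B (s t : R) P
    (u := dot (P - A) (P - A) - s ^+ 2 * dot (P - B) (P - B) + t ^+ 2) :
  gradient (ovals_poly A B s t) P =
  (4 * u - 8 * t ^+ 2) *: (P - A) - (4 * s ^+ 2 * u) *: (P - B).
Proof.
have gc O (i : 'I_2) : mpoly.meval (P 0) (mpoly.mderiv i (circle_poly O 0)) = 2 * (P - O) 0 i.
  by have /rowP/(_ i) := gradient_circle_poly O 0 P; rewrite mxE [in RHS]mxE.
apply/rowP => i; rewrite !mxE /ovals_poly.
move: (circle_poly A 0) (meval_circle_poly A 0 P) (gc A i) => pa ea ga.
move: (circle_poly B 0) (meval_circle_poly B 0 P) (gc B i) => pb eb gb.
rewrite !(mpoly.mderivB, mpoly.mderivD, mpoly.mderivM, mpoly.mderivC).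
rewrite !(mpoly.mevalB, mpoly.mevalD, mpoly.mevalM, mpoly.mevalC, mpoly.meval0).
rewrite ea eb ga gb !mxE /u; ring.
Qed.

(** From the equation the signed distances are recovered as [a = u / (2 * t)] and
    [b = (t - a) / s]. *)
Lemma ovals_polyP A B (s t : R) M : 0 < s -> 0 < t ->
  mpoly.meval (M 0) (ovals_poly A B s t) = 0 <-> cartesian_ovals A B s t M.
Proof.
move=> s0 t0; rewrite meval_ovals_poly; split=> [e|/cartesian_ovalsP[a [b [<- <- <-]]]].
  apply/cartesian_ovalsP.
  set da := dot (M - A) (M - A) in e *; set db := dot (M - B) (M - B) in e *.
  set u := da - s ^+ 2 * db + t ^+ 2 in e *.
  have ea : (u / (2 * t)) ^+ 2 = da.
    have -> : da = u ^+ 2 / (4 * t ^+ 2).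
      by move/subr0_eq: e => ->; field; rewrite gt_eqF.
    by field; rewrite gt_eqF.
  exists (u / (2 * t)), ((t - u / (2 * t)) / s); split=> //.
    rewrite expr_div_n sqrrB ea.
    have -> : t ^+ 2 - t * (u / (2 * t)) *+ 2 + da = s ^+ 2 * db.
      have -> : t * (u / (2 * t)) *+ 2 = u by field; rewrite gt_eqF.
      by rewrite /u; ring.
    by field; rewrite gt_eqF.
  by field; rewrite !gt_eqF.
ring.
Qed.

(** The union of the four ovals is the zero set of [ovals_poly], hence already closed. *)
Lemma zariski_closure_ovals A B (s t : R) : 0 < s -> 0 < t ->
  zariski_closure (cartesian_ovals A B s t) = cartesian_ovals A B s t.
Proof.
move=> s0 t0; apply/seteqP; split=> P SP; last by move=> f; apply.
by apply/ovals_polyP => //; apply: SP => Q SQ; apply/ovals_polyP.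
Qed.

(** On the ovals [u = 2 * t * a] and [a - t = - s * b], so [- 8 * s * t] factors out. *)
Lemma gradient_ovals A B (s t : R) M a b :
  a ^+ 2 = dot (M - A) (M - A) -> b ^+ 2 = dot (M - B) (M - B) -> a + s * b = t ->
  gradient (ovals_poly A B s t) M =
  (- 8 * s * t) *: (b *: (M - A) + (s * a) *: (M - B)).
Proof.
move=> ea eb <-; rewrite gradient_ovals_poly -ea -eb.
by apply: row2P; rewrite !mxE; ring.
Qed.

(** The nonzero gradient comes from [gradient_ovals]; the nonzero tangent vector is the velocity of
    an explicit arc. As [M] is off the line through [A] and [B], the square root in that arc has a
    positive radicand and is differentiable. *)
Lemma ovals_smooth A B (s t : R) M a b : A != B -> 0 < s -> 0 < t ->
  a ^+ 2 = dot (M - A) (M - A) -> b ^+ 2 = dot (M - B) (M - B) -> a + s * b = t ->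
  cross (M - A) (M - B) != 0 -> b *: (M - A) + (s * a) *: (M - B) != 0 ->
  smooth_point (cartesian_ovals A B s t) M.
Proof.
move=> AB s0 t0 ea eb et c0 g0.
have SM : cartesian_ovals A B s t M by apply/cartesian_ovalsP; exists a, b.
pose e := B - A; have e0 : e != 0 by rewrite subr_eq0 eq_sym.
pose d2 := dot e e; have d0 : 0 < d2 := dot_gt0 e0.
have d2n0 := lt0r_neq0 d0; have sn0 := lt0r_neq0 s0.
(* Near [M] the ovals are parametrized by the signed distance [w] to [A]: the point at signed
   distances [w] and [(t - w) / s] has coordinates [xi w] and [eta w] along [e] and its
   rotation by a right angle, up to the factor [d2]. *)
pose xi w := (w ^+ 2 - ((t - w) / s) ^+ 2 + d2) / 2.
pose rad w := d2 * w ^+ 2 - xi w ^+ 2.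
pose eta0 := cross e (M - A).
have eb' : b = (t - a) / s by rewrite -et; field.
have xia : xi a = dot (M - A) e.
  by rewrite /xi -eb' ea eb /d2 /e /dot !mxE; field.
have rada : rad a = eta0 ^+ 2.
  rewrite /rad xia ea /d2 /eta0 /e /dot /cross !mxE; ring.
have eta0n0 : eta0 != 0.
  by rewrite (_ : eta0 = cross (M - A) (M - B)) // /eta0 /e /cross !mxE; ring.
(* The sign of [eta0]: it selects the arc through [M] instead of its mirror image in the line
   through [A] and [B]. *)
pose sg := eta0 / Num.sqrt (rad a).
have rad0 : 0 < rad a by rewrite rada exprn_even_gt0.
have sga : sg * Num.sqrt (rad a) = eta0 by rewrite /sg divfK // sqrtr_eq0 -ltNge.
have sg2 : sg ^+ 2 = 1.
  by rewrite /sg expr_div_n sqr_sqrtr ?ltW // rada divff // sqrf_eq0.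
pose eta w := sg * Num.sqrt (rad w).
pose c w := A + (xi w / d2) *: e + (eta w / d2) *: (\row_i (if i == 0 then - e 0 1 else e 0 0)).
have xiD (w : R) : is_derive w 1 xi (w + (t - w) / s ^+ 2).
  by rewrite /xi; apply: is_derive_eq; rewrite /GRing.scale /=; field.
have radD (w : R) : is_derive w 1 rad (d2 * 2 * w - 2 * xi w * (w + (t - w) / s ^+ 2)).
  rewrite /rad; apply: is_derive_eq; rewrite /GRing.scale /=; ring.
pose deta := sg * ((2 * Num.sqrt (rad a))^-1 * (d2 * 2 * a - 2 * xi a * (a + (t - a) / s ^+ 2))).
have etaD : is_derive a 1 eta deta.
  have h1 := is_derive1_sqrt rad0.
  rewrite /eta /deta; apply: is_derive_eq; rewrite /GRing.scale /=; ring.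
pose dxi := a + (t - a) / s ^+ 2.
pose v : 'rV[R]_2 := (dxi / d2) *: e + (deta / d2) *: (\row_i (if i == 0 then - e 0 1 else e 0 0)).
have ca : c a = M.
  rewrite /c /eta sga xia /eta0; apply: row2P; rewrite !mxE /=;
  move: d2n0; rewrite /d2 /e /dot /cross !mxE => d2n0; field; exact: d2n0.
have [/eqP an0] : a != 0.
  apply: contraNneq c0 => h; move: ea; rewrite h expr0n /= => /esym ea.
  have [->|/dot_gt0] := eqVneq (M - A) 0; first by rewrite /cross !mxE !mul0r subrr.
  by rewrite ea ltxx.
apply: (@smooth_point_tangent _ _ (ovals_poly A B s t) _ v) => //.
- by move=> P /ovals_polyP; apply.
- by rewrite (gradient_ovals ea eb et) scaler_eq0 negb_or g0 andbT
    !mulf_neq0 ?oppr_eq0 ?pnatr_eq0 // lt0r_neq0.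
(* Half the derivative at [a] of [xi ^+ 2 + eta ^+ 2 = d2 * w ^+ 2]. As [a] is nonzero, the velocity
   cannot vanish. *)
- have key : xi a * dxi + eta0 * deta = d2 * a.
    rewrite -sga /deta -/dxi.
    have r0 : Num.sqrt (rad a) != 0 by rewrite sqrtr_eq0 -ltNge.
    transitivity (xi a * dxi + sg ^+ 2 * (d2 * a - xi a * dxi)); first by field.
    by rewrite sg2; ring.
  have dv : dxi = dot v e /\ deta = cross e v.
    split; rewrite /v; move: d2n0; rewrite /d2 /dot /cross !mxE /= => d2n0;
    field; exact: d2n0.
  apply: contra_eq_neq key => v0; case: dv => -> ->.
  have -> : xi a * dot v e + eta0 * cross e v = 0 by rewrite v0 /dot /cross !mxE; ring.
  by rewrite eq_sym mulf_neq0 //; apply/eqP.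
- rewrite -ca; apply: tangent_space_curve => [i|].
    rewrite /c /v; under eq_fun do rewrite !mxE; rewrite !mxE.
    by apply: is_derive_eq; rewrite /GRing.scale /= /dxi; ring.
  have : \forall w \near a, 0 < rad w.
    have cr : {for a, continuous rad}.
      by apply/differentiable_continuous/derivable1_diffP; have [] := radD a.
    exact: (cvgr_gt (rad a) cr 0 rad0).
  apply: filterS => w rw; apply/cartesian_ovalsP; exists w, ((t - w) / s).
  have ew : eta w ^+ 2 = rad w by rewrite /eta exprMn sg2 mul1r sqr_sqrtr // ltW.
  have cA : dot (c w - A) (c w - A) = (xi w ^+ 2 + eta w ^+ 2) / d2.
    by rewrite /c; move: d2n0; rewrite /d2 /dot !mxE /= => d2n0; field; exact: d2n0.
  have cAe : dot (c w - A) e = xi w.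
    by rewrite /c; move: d2n0; rewrite /d2 /dot !mxE /= => d2n0; field; exact: d2n0.
  have eA : dot (c w - A) (c w - A) = w ^+ 2.
    by rewrite cA ew /rad; field.
  split=> //.
    have -> : c w - B = (c w - A) - e by rewrite /e opprB addrA subrK.
    by rewrite dotB eA cAe -/d2 /xi; field.
  by field.
Qed.

End Ovals.

(** * Refracted rays at the Apollonius circle *)

Section Rays.
Context {R : realType}.
Implicit Types (A B M O P Q X u v w : 'rV[R]_2) (l : set 'rV[R]_2).

(** Allowing both [n] and [- n] leaves only the square of the law of refraction, and
    [line_angle_sin] turns squared sines into cross products. The angles thus disappear. *)
Lemma refracted_rayP A O (r n : R) X l : 0 < r -> circle O r X -> X != A ->
  (refracted_ray A (circle O r) n X l \/ refracted_ray A (circle O r) (- n) X l) <->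
  exists v, [/\ v != 0, l = line X v &
    cross (X - O) (X - A) ^+ 2 * dot v v =
    n ^+ 2 * cross (X - O) v ^+ 2 * dot (X - A) (X - A)].
Proof.
move=> r0 XC XA; have [sX nX] := circle_normal r0 XC.
have w0 : X - A != 0 by rewrite subr_eq0.
have u0 : X - O != 0.
  by apply: contraTneq r0 => e; rewrite -XC e /enorm /dot !mxE !mulr0 addr0 sqrtr0 ltxx.
have lA : line A (X - A) = line X (X - A).
  by apply: line_base; exists 1 => //; rewrite scale1r addrC subrK.
split.
  have main m : m ^+ 2 = n ^+ 2 -> refracted_ray A (circle O r) m X l ->
      exists v, [/\ v != 0, l = line X v &
        cross (X - O) (X - A) ^+ 2 * dot v v =
        n ^+ 2 * cross (X - O) v ^+ 2 * dot (X - A) (X - A)].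
    move=> mn [_ [_ [N [ti [to [/nX -> ai ao e]]]]]].
    rewrite lA in ai; have [_ lE] := ao; rewrite rotation_line in lE.
    have v0 : rotation to (X - O) != 0.
      have := dot_gt0 u0.
      have <- : dot (rotation to (X - O)) (rotation to (X - O)) = dot (X - O) (X - O).
        rewrite -[RHS]mul1r -(cos2Dsin2 to) /dot [LHS]/= !mxE /=; ring.
      by apply: contraTneq => ->; rewrite /dot !mxE mul0r addr0 ltxx.
    exists (rotation to (X - O)); split=> //.
    rewrite lE in ao; rewrite (line_angle_sin u0 w0 ai) (line_angle_sin u0 v0 ao).
    by rewrite e exprMn mn; ring.
  by case; apply: main; rewrite ?sqrrN.
move=> [v [v0 -> rel]].
have [ti ai] := line_angle_ex X u0 w0; have [to ao] := line_angle_ex X u0 v0.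
have : sin ti ^+ 2 = (n * sin to) ^+ 2.
  move: rel; rewrite (line_angle_sin u0 w0 ai) (line_angle_sin u0 v0 ao).
  have gu := lt0r_neq0 (dot_gt0 u0); have gv := lt0r_neq0 (dot_gt0 v0).
  have gw := lt0r_neq0 (dot_gt0 w0) => rel.
  apply: (mulIf (mulf_neq0 (mulf_neq0 gu gw) gv)).
  by rewrite !mulrA rel; ring.
have nl : normal_line (circle O r) X (line X (X - O)) by apply/nX.
move/eqP; rewrite eqf_sqr -mulNr => /orP[]/eqP e; [left|right];
  (do 2 split=> //); exists (line X (X - O)), ti, to; split=> //; by rewrite lA.
Qed.

(** Expresses the radius at [X] by [X - A] and [X - B], so that the center can be eliminated. *)
Lemma center_ray A B (s : R) X (k := s ^+ 2 - 1) : k != 0 ->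
  X - (A + (s ^+ 2 / k) *: (B - A)) = k^-1 *: (s ^+ 2 *: (X - B) - (X - A)).
Proof.
by move=> k0; apply: row2P; rewrite !mxE; move: k0; rewrite /k => k0; field.
Qed.

Lemma apollonius A B (s : R) X : A != B -> 0 < s -> s ^+ 2 - 1 != 0 ->
  circle (A + (s ^+ 2 / (s ^+ 2 - 1)) *: (B - A))
    (s * enorm (A - B) / `|s ^+ 2 - 1|) X <->
  dot (X - A) (X - A) = s ^+ 2 * dot (X - B) (X - B).
Proof.
move=> AB s0 k0; have AB0 : A - B != 0 by rewrite subr_eq0.
set r := s * enorm _ / _.
have r0 : 0 < r by apply: divr_gt0; rewrite ?normr_gt0 ?pmulr_rgt0 ?enorm_gt0.
have r2 : r ^+ 2 = s ^+ 2 * dot (A - B) (A - B) / (s ^+ 2 - 1) ^+ 2.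
  by rewrite /r expr_div_n exprMn enorm_sqr real_normK // num_real.
set O := A + _; have XO : X - O = _ := center_ray A B X k0.
(* The power of [X] with respect to the circle is, up to the factor [s ^+ 2 - 1], the defect in the
   Apollonius equation. *)
have key : (s ^+ 2 - 1) * (dot (X - O) (X - O) - r ^+ 2) =
    s ^+ 2 * dot (X - B) (X - B) - dot (X - A) (X - A).
  by rewrite XO r2 /dot !mxE; field.
split=> [/(circleP _ _ r0) e|e].
  by apply/esym/subr0_eq; rewrite -key e subrr mulr0.
apply/(circleP _ _ r0)/subr0_eq/(mulfI k0); rewrite key e subrr mulr0 //.
Qed.

(** This is [refracted_rayP] with center and denominators cleared: the polynomial relation that both
    inclusions use. *)
Lemma caustic_rayP A B (s t : R) X l (k := s ^+ 2 - 1)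
    (C := circle (A + (s ^+ 2 / k) *: (B - A)) (s * enorm (A - B) / `|k|))
    (n := s * enorm (A - B) / t) :
  A != B -> 0 < s -> 0 < t -> k != 0 ->
  dot (X - A) (X - A) = s ^+ 2 * dot (X - B) (X - B) ->
  (refracted_ray A C n X l \/ refracted_ray A C (- n) X l) <->
  exists v, [/\ v != 0, l = line X v &
    s ^+ 2 * t ^+ 2 * cross (X - A) (X - B) ^+ 2 * dot v v =
    dot (A - B) (A - B) * cross (X - A - s ^+ 2 *: (X - B)) v ^+ 2 * dot (X - A) (X - A)].
Proof.
move=> AB s0 t0 k0 XC; have AB0 : A - B != 0 by rewrite subr_eq0.
have r0 : 0 < s * enorm (A - B) / `|k|.
  by apply: divr_gt0; rewrite ?normr_gt0 ?pmulr_rgt0 ?enorm_gt0.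
have CX : C X by apply/(apollonius X AB s0 k0).
have XA : X != A.
  apply: contraNneq AB0 => XA; move: XC; rewrite XA subrr.
  move/esym/eqP; rewrite {2}/dot !mxE mul0r addr0 mulf_eq0 expf_eq0 /= gt_eqF //=.
  by have [->//|/dot_gt0/lt0r_neq0/negPf->] := eqVneq (A - B) 0.
have XO := center_ray A B X k0.
have n2 : n ^+ 2 = s ^+ 2 * dot (A - B) (A - B) / t ^+ 2.
  by rewrite /n expr_div_n exprMn enorm_sqr.
have eqv v : (cross (k^-1 *: (s ^+ 2 *: (X - B) - (X - A))) (X - A) ^+ 2 * dot v v =
    n ^+ 2 * cross (k^-1 *: (s ^+ 2 *: (X - B) - (X - A))) v ^+ 2 * dot (X - A) (X - A)) <->
    (s ^+ 2 * t ^+ 2 * cross (X - A) (X - B) ^+ 2 * dot v v =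
    dot (A - B) (A - B) * cross (X - A - s ^+ 2 *: (X - B)) v ^+ 2 * dot (X - A) (X - A)).
  have e1 : cross (k^-1 *: (s ^+ 2 *: (X - B) - (X - A))) (X - A) =
      - (s ^+ 2 / k * cross (X - A) (X - B)).
    rewrite /cross !mxE; ring.
  have e2 : cross (k^-1 *: (s ^+ 2 *: (X - B) - (X - A))) v =
      - (cross (X - A - s ^+ 2 *: (X - B)) v / k).
    rewrite /cross !mxE; ring.
  have sn0 := lt0r_neq0 s0; have tn0 := lt0r_neq0 t0.
  (* The factor between the two forms of the relation. *)
  have cn0 : k ^+ 2 * t ^+ 2 / s ^+ 2 != 0 by rewrite !mulf_neq0 ?invr_neq0 // expf_neq0.
  rewrite e1 e2 n2; move: (cross _ v) (cross _ (X - B)) (dot _ _) (dot _ _) (dot _ _).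
  move=> x y z p q; split=> h; last apply: (mulfI cn0).
    have := congr1 (fun x => k ^+ 2 * t ^+ 2 / s ^+ 2 * x) h => h'.
    by apply: etrans (etrans h' _); field; rewrite ?k0 ?sn0 ?tn0.
  by apply: etrans (etrans h _); field; rewrite ?k0 ?sn0 ?tn0.
split=> [/(refracted_rayP n l r0 CX XA)[v [v0 lE]]|[v [v0 lE /eqv rel]]].
  by rewrite XO => /eqv rel; exists v.
by apply/(refracted_rayP n l r0 CX XA); exists v; rewrite XO.
Qed.

(* [X] is the image, under the inversion centered at [M], of the point dividing the images of
   [A] and [B] in the ratio given by the weights [a] and [s * b]; the circle through [A], [B]
   and [M] meets the Apollonius circle there. *)
Lemma normal_meets_circle A B (s t : R) M a b
    (g := b *: (M - A) + (s * a) *: (M - B)) :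
  A != B -> 0 < s -> 0 < t -> a != 0 -> b != 0 -> g != 0 ->
  a ^+ 2 = dot (M - A) (M - A) -> b ^+ 2 = dot (M - B) (M - B) -> a + s * b = t ->
  exists X, [/\ dot (X - A) (X - A) = s ^+ 2 * dot (X - B) (X - B),
    line M g = line X g &
    s ^+ 2 * t ^+ 2 * cross (X - A) (X - B) ^+ 2 * dot g g =
    dot (A - B) (A - B) * cross (X - A - s ^+ 2 *: (X - B)) g ^+ 2 * dot (X - A) (X - A)].
Proof.
move=> AB s0 t0 a0 b0 g0 ea eb et.
pose P := M - A; pose Q := M - B; pose pq := 2 * dot P Q.
pose d2 := a ^+ 2 + b ^+ 2 - pq.
have dE : dot (A - B) (A - B) = d2.
  have -> : A - B = Q - P by rewrite /P /Q opprB addrCA addrAC subrr add0r.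
  by rewrite dotB -ea -eb /d2 /pq /dot; ring.
pose D := t * (s * a + b) - s * d2.
have gE : dot g g = a * b * D.
  (* [D] is the cofactor of [a * b] in [dot g g], by [t * (s * a + b) = (a + s * b) * (s * a +
     b)]. *)
  rewrite /g dot_comb -ea -eb -/P -/Q -/pq /D /d2 -et; ring.
have D0 : D != 0.
  by have := dot_gt0 g0; rewrite gE; apply: contraTneq => ->; rewrite mulr0 ltxx.
(* Seen from [M], the weighted mean of the unit inverses of [A] and [B] is [- g / (t * a * b)].
   Inverting it back divides by [dot g g / (t * a * b) ^+ 2], which leaves the coefficient
   [- t / D]. *)
pose X := M + (- (t / D)) *: g.
have XA : X - A = (s * (t * a - d2) / D) *: P + (- (s * t * a / D)) *: Q.
  have -> : X - A = P - (t / D) *: g by rewrite /X /P scaleNr addrAC.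
  apply: row2P; rewrite /g -/P -/Q !mxE; move: (P 0 0) (P 0 1) (Q 0 0) (Q 0 1) D0;
    by rewrite /D => p0 p1 q0 q1 D0; field.
have XB : X - B = (- (t * b) / D) *: P + ((t * b - s * d2) / D) *: Q.
  have -> : X - B = Q - (t / D) *: g by rewrite /X /Q scaleNr addrAC.
  apply: row2P; rewrite /g -/P -/Q !mxE; move: (P 0 0) (P 0 1) (Q 0 0) (Q 0 1) D0;
    by rewrite /D => p0 p1 q0 q1 D0; field.
have XA2 : dot (X - A) (X - A) = s ^+ 2 * d2 * (a * b) / D.
  rewrite XA dot_comb -ea -eb -/pq.
  have -> : pq = a ^+ 2 + b ^+ 2 - d2 by rewrite /d2; ring.
  move: D0; rewrite /D -et; move: (d2) => d D0; field; exact: D0.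
have XB2 : dot (X - B) (X - B) = d2 * (a * b) / D.
  rewrite XB dot_comb -ea -eb -/pq.
  have -> : pq = a ^+ 2 + b ^+ 2 - d2 by rewrite /d2; ring.
  move: D0; rewrite /D -et; move: (d2) => d D0; field; exact: D0.
exists X; split.
- by rewrite XA2 XB2; ring.
- by rewrite /X lineD.
have cAB : cross (X - A) (X - B) = - (s * d2 / D) * cross P Q.
  rewrite XA XB cross_comb; congr (_ * _).
  move: D0; rewrite /D -et; move: (d2) => d D0; field; exact: D0.
have cw : cross (X - A - s ^+ 2 *: (X - B)) g = s * t * cross P Q.
  have -> : X - A - s ^+ 2 *: (X - B) = ((s * (t * a - d2) / D) - s ^+ 2 * (- (t * b) / D)) *: P +
     (- (s * t * a / D) - s ^+ 2 * ((t * b - s * d2) / D)) *: Q.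
    by rewrite XA XB; apply: row2P; rewrite !mxE; ring.
  rewrite /g cross_comb; congr (_ * _).
  move: D0; rewrite /D -et; move: (d2) => d D0; field; exact: D0.
rewrite cAB cw gE XA2 dE; move: (cross P Q) => c.
by move: (D) D0 => D' D0; field.
Qed.

(* With [al = X - A], [be = X - B] and [M = X + v], the two squares are the signed distances of
   [M] to [A] and [B]; they come from inverting the formula for [X] in [normal_meets_circle]. *)
Lemma ray_distances (al be : 'rV[R]_2) (s t x y : R) (d2 := dot (al - be) (al - be))
    (h := dot be be) (v := x *: al + y *: be) :
  d2 != 0 -> s != 0 -> t != 0 -> dot al al = s ^+ 2 * h -> y + s ^+ 2 * x = - t ^+ 2 / d2 ->
  dot v v = t ^+ 2 * h / d2 ->
  [/\ (- y * d2 / t) ^+ 2 = dot (al + v) (al + v),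
      (- x * s * d2 / t) ^+ 2 = dot (be + v) (be + v),
      - y * d2 / t + s * (- x * s * d2 / t) = t &
      h * (1 + x + y) * t ^+ 2 = - x * y * d2 ^+ 2].
Proof.
move=> d0 s0 t0 eal exy ev.
have e2 : 2 * dot al be = (1 + s ^+ 2) * h - d2.
  by rewrite /d2 dotB eal -/h; ring.
have ey : y = - s ^+ 2 * x - t ^+ 2 / d2.
  by apply: (addIr (s ^+ 2 * x)); rewrite exy; field.
have key : h * (1 + x + y) * t ^+ 2 = - x * y * d2 ^+ 2.
  have := ev; rewrite /v dot_comb eal e2 -/h => e.
  have {}e : h * ((y + s ^+ 2 * x) * (x + y)) - x * y * d2 = t ^+ 2 * h / d2.
    by rewrite -e; ring.
  rewrite exy in e.
  have e' : t ^+ 2 * h / d2 * d2 = t ^+ 2 * h by field.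
  have : h * (- t ^+ 2 / d2 * (x + y)) * d2 - x * y * d2 * d2 = t ^+ 2 * h.
    by rewrite -e' -e; ring.
  have -> : h * (- t ^+ 2 / d2 * (x + y)) * d2 = - h * t ^+ 2 * (x + y) by field.
  by move=> e3; rewrite -!mulrA; lra.
split=> //.
- have -> : al + v = (1 + x) *: al + y *: be by rewrite /v scalerDl scale1r addrA.
  rewrite dot_comb eal e2 -/h; apply: (mulIf (expf_neq0 2 t0)).
  (* Apart from its [d2] term the quadratic form is [h * (1 + x + y) * (s ^+ 2 + (y + s ^+ 2 * x))];
     this exposes the left side of [key]. *)
  transitivity (s ^+ 2 * (h * (1 + x + y) * t ^+ 2) - t ^+ 2 / d2 * (h * (1 + x + y) * t ^+ 2)
     - (1 + x) * y * d2 * t ^+ 2); last first.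
    rewrite ey; field; exact: d0.
  by rewrite key ey; field; rewrite ?d0 ?t0.
- have -> : be + v = x *: al + (1 + y) *: be by rewrite /v scalerDl scale1r addrCA.
  rewrite dot_comb eal e2 -/h; apply: (mulIf (expf_neq0 2 t0)).
  transitivity ((h * (1 + x + y) * t ^+ 2) - t ^+ 2 / d2 * (h * (1 + x + y) * t ^+ 2)
     - x * (1 + y) * d2 * t ^+ 2); last first.
    rewrite ey; field; exact: d0.
  by rewrite key ey; field; rewrite ?d0 ?t0.
- by rewrite ey; field; rewrite ?d0 ?t0.
Qed.


End Rays.

(** Cramer's rule. *)
Lemma cross_basis (R : realType) (al be v : 'rV[R]_2) : cross al be != 0 ->
  v = (cross v be / cross al be) *: al + (cross al v / cross al be) *: be.
Proof.
by rewrite /cross => c0; apply: row2P; rewrite !mxE; field.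
Qed.

(** The point [M] is sought as [X + mu *: v], with [mu] fixed by the linear condition of
    [ray_distances]; the refraction relation then supplies the required length. Avoiding [O] keeps
    [mu] finite, and avoiding [A] and [B] keeps the signed distances nonzero. *)
Lemma ray_is_normal (R : realType) (A B X v : 'rV[R]_2) (s t : R)
    (O := A + (s ^+ 2 / (s ^+ 2 - 1)) *: (B - A)) :
  A != B -> 0 < s -> 0 < t -> s ^+ 2 - 1 != 0 ->
  dot (X - A) (X - A) = s ^+ 2 * dot (X - B) (X - B) -> v != 0 ->
  s ^+ 2 * t ^+ 2 * cross (X - A) (X - B) ^+ 2 * dot v v =
  dot (A - B) (A - B) * cross (X - A - s ^+ 2 *: (X - B)) v ^+ 2 * dot (X - A) (X - A) ->
  ~ line X v A -> ~ line X v B -> ~ line X v O ->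
  exists M a b, [/\ a ^+ 2 = dot (M - A) (M - A), b ^+ 2 = dot (M - B) (M - B),
    a + s * b = t, cross (M - A) (M - B) != 0 &
    b *: (M - A) + (s * a) *: (M - B) != 0 /\
    line X v = line M (b *: (M - A) + (s * a) *: (M - B))].
Proof.
move=> AB s0 t0 k0 XC v0 rel lA lB lO.
pose al := X - A; pose be := X - B.
have sn0 := lt0r_neq0 s0; have tn0 := lt0r_neq0 t0.
have d0 : dot (A - B) (A - B) != 0 by apply/lt0r_neq0/dot_gt0; rewrite subr_eq0.
have dE : dot (A - B) (A - B) = dot (al - be) (al - be).
  by rewrite /al /be /dot !mxE; ring.
have al0 : dot al al != 0.
  apply/lt0r_neq0/dot_gt0; rewrite subr_eq0; apply: contra_notN lA => /eqP <-.
  by exists 0; rewrite // scale0r addr0.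
have cv0 : cross (al - s ^+ 2 *: be) v != 0.
  apply: contra_notN lO => /eqP c0; apply: line_crossP => //.
  rewrite -opprB (center_ray A B X k0) -/al -/be.
  transitivity ((s ^+ 2 - 1)^-1 * cross (al - s ^+ 2 *: be) v); last by rewrite c0 mulr0.
  rewrite /cross !mxE; ring.
have c0 : cross al be != 0.
  apply: contra_eq_neq rel => c0; rewrite -/al -/be c0 expr0n /= mulr0 mul0r eq_sym.
  by rewrite !mulf_neq0 // expf_neq0.
pose d2 := dot (al - be) (al - be); rewrite -/al -/be dE -/d2 in rel d0.
(* Solves [exy] for the scale of [v], including its sign, which the length in [ev] leaves open. *)
pose mu := - (t ^+ 2 * cross al be) / (d2 * cross (al - s ^+ 2 *: be) v).
have mu0 : mu != 0 by rewrite !mulf_neq0 ?invr_neq0 ?oppr_eq0 ?mulf_neq0 // expf_neq0.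
pose x := cross (mu *: v) be / cross al be; pose y := cross al (mu *: v) / cross al be.
have vE : mu *: v = x *: al + y *: be := cross_basis (mu *: v) c0.
have exy : y + s ^+ 2 * x = - t ^+ 2 / d2.
  have -> : y + s ^+ 2 * x = mu * cross (al - s ^+ 2 *: be) v / cross al be.
    rewrite /x /y /cross !mxE; ring.
  by rewrite /mu; move: (cross _ v) (cross al be) cv0 c0 => p q p0 q0; field; rewrite ?p0 ?q0 ?d0.
(* Ptolemy's equality, squared. *)
have ev : dot (x *: al + y *: be) (x *: al + y *: be) = t ^+ 2 * dot be be / d2.
  have -> : dot (x *: al + y *: be) (x *: al + y *: be) = mu ^+ 2 * dot v v.
    by rewrite -vE /dot !mxE; ring.
  have -> : dot be be = dot al al / s ^+ 2 by rewrite /al XC mulrC mulKf // expf_neq0.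
  move: rel; rewrite /mu; move: (cross _ v) (cross al be) (dot v v) (dot al al) cv0 c0.
  move=> p q z w p0 q0 rel.
  have -> : z = d2 * p ^+ 2 * w / (s ^+ 2 * t ^+ 2 * q ^+ 2).
    by rewrite -rel; field; rewrite ?sn0 ?tn0 ?q0.
  by field; rewrite ?sn0 ?tn0 ?q0 ?p0 ?d0.
clearbody x y; have [ea eb et key] := ray_distances d0 sn0 tn0 XC exy ev.
rewrite -/d2 in ea eb et key; clearbody d2 mu.
pose M := X + mu *: v.
have MA : M - A = al + (x *: al + y *: be) by rewrite -vE /M addrAC.
have MB : M - B = be + (x *: al + y *: be) by rewrite -vE /M addrAC.
have lM : line X v M by exists mu.
(* By [eb] and [ea], a zero [x] would put [B] on the ray and a zero [y] would put [A] there. *)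
have xy0 : x != 0 /\ y != 0.
  split; apply/eqP => z0.
    apply: lB; suff <- : M = B by [].
    apply/eqP; rewrite -subr_eq0; apply/negPn/negP => /dot_gt0.
    by rewrite MB -eb z0 oppr0 !mul0r expr0n ltxx.
  apply: lA; suff <- : M = A by [].
  apply/eqP; rewrite -subr_eq0; apply/negPn/negP => /dot_gt0.
  by rewrite MA -ea z0 oppr0 !mul0r expr0n ltxx.
case: xy0 => x0 y0.
have xy1 : 1 + x + y != 0.
  apply: contra_eq_neq key => ->; rewrite mulr0 mul0r eq_sym.
  by rewrite !mulf_neq0 ?oppr_eq0 ?expf_neq0.
exists M, (- y * d2 / t), (- x * s * d2 / t); rewrite MA MB; split=> //.
  have -> : cross (al + (x *: al + y *: be)) (be + (x *: al + y *: be)) = (1 + x + y) * cross al be.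
    by rewrite /cross !mxE; ring.
  by rewrite mulf_neq0.
(* The weights are proportional to [x] and [y], and [x *: al + y *: be] is [mu *: v] itself, so the
   normal direction collapses to a multiple of [v]. *)
have -> : (- x * s * d2 / t) *: (al + (x *: al + y *: be)) +
    (s * (- y * d2 / t)) *: (be + (x *: al + y *: be)) =
    (- (s * d2 / t) * (1 + x + y) * mu) *: v.
  by rewrite -[RHS]scalerA vE; apply: row2P; rewrite !mxE; ring.
have n0 : - (s * d2 / t) * (1 + x + y) * mu != 0.
  by rewrite !mulf_neq0 ?oppr_eq0 ?mulf_neq0 ?invr_neq0.
rewrite lineZ // scaler_eq0 negb_or n0 v0; split=> //.
exact: line_base.
Qed.

(** * The two inclusions *)

Theorem proposition2p4 (R : realType) (A B : 'rV[R]_2) (s t : R)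
    (hAB : A != B) (hs : 0 < s) (ht : 0 < t) (hs1 : s != 1) :
  evolute (zariski_closure (cartesian_ovals A B s t)) =
  complete_caustic A
    (circle (A + (s ^+ 2 / (s ^+ 2 - 1)) *: (B - A))
            (s * enorm (A - B) / `|s ^+ 2 - 1|))
    (s * enorm (A - B) / t).
Proof.
have k0 : s ^+ 2 - 1 != 0.
  have -> : s ^+ 2 - 1 = (s - 1) * (s + 1) by ring.
  by rewrite mulf_neq0 ?subr_eq0 // lt0r_neq0 // addr_gt0.
have sn0 := lt0r_neq0 hs.
rewrite zariski_closure_ovals // /evolute /complete_caustic.
set F1 := [set l | _]; set F2 := [set l | exists X, _].
have vQ : vanishing_ideal (cartesian_ovals A B s t) (ovals_poly A B s t).
  by move=> P /ovals_polyP; apply.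
have c8 : - 8 * s * t != 0 by rewrite !mulf_neq0 ?oppr_eq0 ?pnatr_eq0 // lt0r_neq0.
have base_line (P u : 'rV[R]_2) : line P u P by exists 0; rewrite // scale0r addr0.
apply/seteqP; split.
(* Evolute into caustic. Only normals at [A] or [B] are lost; [envelope_pencil] discards one pencil
   at a time, hence the intermediate union. *)
- apply: (@subset_trans _ (envelope (F2 `|` [set l | l A]))); last first.
    exact: (@envelope_pencil _ _ _ A (fun=> id)).
  apply: (@envelope_pencil _ _ _ B) => l [M sM nM].
  have [SM _] := sM.
  have [MA|MA] := eqVneq M A.
    by left; right; case: nM => nu _ ->; rewrite MA; apply: base_line.
  have [MB|MB] := eqVneq M B.
    by right; case: nM => nu _ ->; rewrite MB; apply: base_line.
  have [a [b [ea eb et]]] := (cartesian_ovalsP A B s t M).1 SM.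
  have MA2 := dot_gt0 (_ : M - A != 0); have MB2 := dot_gt0 (_ : M - B != 0).
  have a0 : a != 0.
    by apply: contraTneq (MA2 _); rewrite ?subr_eq0 // -ea => ->; rewrite expr0n ltxx.
  have b0 : b != 0.
    by apply: contraTneq (MB2 _); rewrite ?subr_eq0 // -eb => ->; rewrite expr0n ltxx.
  set g := b *: (M - A) + (s * a) *: (M - B).
  have g0 : g != 0.
    (* If [g] vanished, comparing the squared lengths of its two terms would give [s ^+ 2 = 1]. *)
    apply: contra_neq k0 => /eqP; rewrite addr_eq0 => /eqP e.
    have : b ^+ 2 * a ^+ 2 * 1 = b ^+ 2 * a ^+ 2 * s ^+ 2.
      have := congr1 (fun w => dot w w) e.
      have dZ (k : R) w : dot (k *: w) (k *: w) = k ^+ 2 * dot w w.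
        by rewrite /dot !mxE; ring.
      rewrite -scaleNr !dZ -ea -eb => e2; rewrite mulr1 [LHS]e2; ring.
    by move/(mulfI (mulf_neq0 (expf_neq0 2 b0) (expf_neq0 2 a0))) => <-; rewrite subrr.
  have gE := gradient_ovals ea eb et.
  have gn0 : gradient (ovals_poly A B s t) M != 0.
    by rewrite gE scaler_eq0 negb_or c8.
  have lE := (normal_line_gradient l vQ gn0 sM).1 nM.
  rewrite gE lineZ // -/g in lE.
  left; left.
  have [X [XC gX rel]] := normal_meets_circle hAB hs ht a0 b0 g0 ea eb et.
  exists X; apply/(caustic_rayP l hAB hs ht k0 XC); exists g; split=> //.
  by rewrite lE.
(* Caustic into evolute, discarding the rays through [A], [B] and the center [O]. *)
- set O := A + _ in F2 *.
  apply: (@subset_trans _ (envelope (F1 `|` [set l | l A]))); last first.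
    exact: (@envelope_pencil _ _ _ A (fun=> id)).
  apply: (@subset_trans _ (envelope ((F1 `|` [set l | l A]) `|` [set l | l B]))); last first.
    exact: (@envelope_pencil _ _ _ B (fun=> id)).
  apply: (@envelope_pencil _ _ _ O) => l [X Xl].
  have [lA|lA] := pselect (l A); first by left; left; right.
  have [lB|lB] := pselect (l B); first by left; right.
  have [lO|lO] := pselect (l O); first by right.
  left; left; left.
  have CX : circle O (s * enorm (A - B) / `|s ^+ 2 - 1|) X by case: Xl => -[[]].
  have XC := (apollonius X hAB hs k0).1 CX.
  have [v [v0 lE rel]] := (caustic_rayP l hAB hs ht k0 XC).1 Xl.
  rewrite lE in lA lB lO.
  have [M [a [b [ea eb et c0 [g0 lM]]]]] := ray_is_normal hAB hs ht k0 XC v0 rel lA lB lO.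
  have sM := ovals_smooth hAB hs ht ea eb et c0 g0.
  exists M => //.
  have gE := gradient_ovals ea eb et.
  have gn0 : gradient (ovals_poly A B s t) M != 0.
    by rewrite gE scaler_eq0 negb_or c8.
  by apply/(normal_line_gradient l vQ gn0 sM); rewrite gE lineZ // lE.
Qed.
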